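(* Let $n,k$ be positive integers. There exists a Heffter array $H(n;k)$ if and only if $3\le k\le n$.
   Context: A Heffter array $H(n;k)$ is an $n\times n$ array in which some cells are filled with nonzero integers and the others are empty, such that: each row and each column contains exactly $k$ filled cells; the entries of every row and of every column sum to $0$ modulo $2nk+1$; and for each integer $1\le x\le nk$, exactly one of $x$ or $-x$ appears in the array, and it appears exactly once (so the multiset of absolute values of the $nk$ entries is exactly $\{1,2,\dots,nk\}$). *)

(* Defs.v *)
From mathcomp Require Import all_boot all_order all_algebra.
Set Implicit Arguments. Unset Strict Implicit. Unset Printing Implicit Defensive.
Import GRing.Theory Num.Theory.

(* An n x n partially filled array with integer entries is modelled as a
   function A : 'I_n -> 'I_n -> int, where the value 0 encodes an empty cell
   (filled cells contain nonzero integers, so this is unambiguous). *)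

Definition filled_row (n : nat) (A : 'I_n -> 'I_n -> int) (i : 'I_n) : {set 'I_n} :=
  [set j | A i j != 0%R].

Definition filled_col (n : nat) (A : 'I_n -> 'I_n -> int) (j : 'I_n) : {set 'I_n} :=
  [set i | A i j != 0%R].

Definition is_heffter (n k : nat) (A : 'I_n -> 'I_n -> int) : Prop :=
  (forall i : 'I_n, #|filled_row A i| = k) /\
  (forall j : 'I_n, #|filled_col A j| = k) /\
  (forall i : 'I_n, ((2 * n * k + 1)%:Z %| (\sum_(j < n) A i j)%R)%Z) /\
  (forall j : 'I_n, ((2 * n * k + 1)%:Z %| (\sum_(i < n) A i j)%R)%Z) /\
  (forall i j : 'I_n, A i j != 0%R -> (absz (A i j) <= n * k)%N) /\
  (forall x : nat, (1 <= x <= n * k)%N ->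
     #|[set p : 'I_n * 'I_n | absz (A p.1 p.2) == x]| = 1).

(* Main.v *)
Require Import Defs.
From mathcomp Require Import all_boot all_order all_algebra.
From mathcomp Require Import zify.
Set Implicit Arguments. Unset Strict Implicit. Unset Printing Implicit Defensive.
Import Order.TTheory GRing.Theory Num.Theory.

(** Necessity: with one or two entries of absolute value at most [nk] per line,
    a sum divisible by [2nk+1] vanishes, so a filled cell would be zero or two
    entries would be opposite.

    Sufficiency: let [M = 2nk+1].  Doubling is invertible modulo [M] and turns
    [{1,..,nk}], up to sign, into [{2,4,..,2a}] together with [{1,3,..,2b-1}],
    for any [a + b = nk].  Hence it is enough to find an integer array with
    zero row and column sums in which each of these absolute values occurs
    once; [a] and [b] are free, which removes the obstruction modulo 4 that
    separates integer from non-integer Heffter arrays.  The filled cells are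
    [k] consecutive cyclic diagonals.  Four further diagonals can always be
    added, so only [k = 3, 5, 6] remain.  Six diagonals split into three pairs
    of diagonals carrying arithmetic progressions whose line sums cancel.  For
    [k = 3] and [k = 5] the outer diagonals come in mirror pairs, related so
    that each column condition follows from a row condition and the middle
    diagonal is determined by a cyclic sequence [w].  What has to be found is a
    sequence in which both the values and the sums (or differences) of
    neighbours take prescribed absolute values, and zigzag sequences of the
    kind used for graceful labellings of cycles do. *)

(** * Necessity of the bounds on [k] *)

Lemma dvdz_small (m : nat) (z : int) : (m %| z)%Z -> (absz z < m)%N -> z = 0%R.
Proof.
rewrite dvdzE /= => dvd_z lt_z; apply/eqP; rewrite -absz_eq0; apply/negPn/negP.
by rewrite -lt0n => /dvdn_leq/(_ dvd_z); rewrite leqNgt lt_z.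
Qed.

Lemma heffter_order_ge3 n k (A : 'I_n -> 'I_n -> int) :
  (0 < n)%N -> (0 < k)%N -> is_heffter k A -> (3 <= k <= n)%N.
Proof.
move=> n0 k0 [row [_ [sum0 [_ [bnd uni]]]]].
pose i0 := Ordinal n0.
have sumE : (\sum_j A i0 j)%R = (\sum_(j in filled_row A i0) A i0 j)%R.
  by rewrite (bigID (fun j => j \in filled_row A i0)) /= [X in (_ + X)%R]big1 ?addr0 // => j;
    rewrite inE negbK => /eqP.
have kn : (k <= n)%N by rewrite -(row i0) -[n in (_ <= n)%N]card_ord max_card.
rewrite kn andbT ltnNge; apply/negP => k2.
have [k1|k2'] : k = 1 \/ k = 2 by lia.
  have /eqP/cards1P[j ej] : #|filled_row A i0| = 1 by rewrite row.
  have := sum0 i0; rewrite sumE ej big_set1 => dvd_sum.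
  have Aj : A i0 j != 0%R by have := set11 j; rewrite -ej inE.
  have := bnd _ _ Aj; rewrite k1 => bj.
  by move: Aj; rewrite (dvdz_small dvd_sum) //; lia.
have /eqP/cards2P[j [j' [jj' ej]]] : #|filled_row A i0| = 2 by rewrite row.
have := sum0 i0; rewrite sumE ej big_setU1 ?inE //= big_set1 => dvd_sum.
have Aj : A i0 j != 0%R by have := set21 j j'; rewrite -ej inE.
have Aj' : A i0 j' != 0%R by have := set22 j j'; rewrite -ej inE.
have bj := bnd _ _ Aj; have bj' := bnd _ _ Aj'.
rewrite k2' in bj bj'.
have sum00 := dvdz_small dvd_sum.
have Anorm : absz (A i0 j) = absz (A i0 j') by lia.
have /uni/eqP/cards1P[p ep] : (1 <= absz (A i0 j) <= n * k)%N by rewrite k2'; lia.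
have : (i0, j) \in [set p] by rewrite -ep inE.
have : (i0, j') \in [set p] by rewrite -ep inE /= Anorm.
by rewrite !inE => /eqP<- /eqP[] /eqP; rewrite (negPf jj').
Qed.

(** * Halving modulo an odd number *)

(* For odd [M], a representative of [z / 2] modulo [M]. *)
Definition halfz (M : nat) (z : int) : int :=
  if odd (absz z) then ((z - sgz z * M%:Z) %/ 2)%Z else (z %/ 2)%Z.

Lemma halfzK M z : odd M -> (M %| (2 * halfz M z - z)%R)%Z.
Proof.
move=> oM; apply/dvdzP; rewrite /halfz; case: ifP => oz; last by exists 0%R; lia.
by exists (- sgz z)%R; lia.
Qed.

Lemma abs_halfz_even M z x : absz z = 2 * x -> absz (halfz M z) = x.
Proof. by rewrite /halfz => zx; rewrite ifF; lia. Qed.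

(** Halves of odd values fill [{1,..,N}] from the top downwards, complementing the halves of even
    values. *)
Lemma abs_halfz_odd N z y : absz z = (2 * y).+1 -> y < N ->
  absz (halfz (2 * N + 1) z) = N - y.
Proof. by rewrite /halfz => zx yN; rewrite ifT; lia. Qed.

(** Twice the sum is a multiple of [M], and 2 is invertible modulo [M]. *)
Lemma dvdz_sum_halfz (I : finType) M (z : I -> int) : odd M ->
  (\sum_i z i = 0)%R -> (M %| (\sum_i halfz M (z i))%R)%Z.
Proof.
move=> oM z0.
suff : (M %| (2 * \sum_i halfz M (z i))%R)%Z by rewrite Gauss_dvdzr // coprimezE coprimen2.
have -> : (2 * \sum_i halfz M (z i) = \sum_i (2 * halfz M (z i) - z i))%R.
  by rewrite sumrB z0 subr0 mulr_sumr.
by apply: rpred_sum => i _; apply: halfzK.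
Qed.

(** * Cyclic diagonals *)

Definition addc n i d := if i + d < n then i + d else i + d - n.
Definition subc n j d := if d <= j then j - d else j + n - d.

Lemma ltn_addc n i d : i < n -> d < n -> addc n i d < n.
Proof. by rewrite /addc; case: ifP; lia. Qed.
Lemma ltn_subc n j d : j < n -> d < n -> subc n j d < n.
Proof. by rewrite /subc; case: ifP; lia. Qed.
Lemma addcK n i d : i < n -> d < n -> subc n (addc n i d) i = d.
Proof. by rewrite /subc /addc => i_n d_n; case: (ltnP (i + d) n) => ?; case: ifP; lia. Qed.
Lemma subcK n i j : i < n -> j < n -> addc n i (subc n j i) = j.
Proof. by rewrite /subc /addc => i_n d_n; case: (leqP i j) => ?; case: ifP; lia. Qed.
Lemma subcC n j d : j < n -> d < n -> subc n j (subc n j d) = d.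
Proof. by rewrite /subc => i_n d_n; case: (leqP d j) => ?; case: ifP; lia. Qed.

(* [F d r] is the entry in row [r] and column [r + d] modulo [n]; thus column [c]
   meets diagonal [d] in row [c - d]. *)
Definition balanced n k (F : nat -> nat -> int) :=
  (forall r, r < n -> (\sum_(d < k) F d r = 0)%R) /\
  (forall c, c < n -> (\sum_(d < k) F d (subc n c d) = 0)%R).

Definition in_range (a b x : nat) := if odd x then x < 2 * b else x <= 2 * a.

(** Covering the range suffices: it has [a + b = n * k] elements, as many as there are cells, so
    each occurs once. *)
Definition cyclic_array n k F (a b : nat) :=
  [/\ balanced n k F, a + b = n * k &
      forall x, 0 < x -> in_range a b x ->
        exists d r, [/\ d < k, r < n & absz (F d r) = x]].

Lemma sum_ord_prefix k n (f : nat -> int) : k <= n ->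
  (\sum_(d < n) (if (d < k)%N then f d else 0) = \sum_(d < k) f d)%R.
Proof. by move=> kn; rewrite (big_ord_widen n f kn) [RHS]big_mkcond. Qed.

Lemma heffter_of_cyclic_array n k F a b : 0 < n -> k <= n ->
  cyclic_array n k F a b -> exists A : 'I_n -> 'I_n -> int, is_heffter k A.
Proof.
move=> n0 kn [[rows cols] abnk cover].
pose N := n * k; pose M := 2 * N + 1.
have oM : odd M by rewrite /M; lia.
pose B d r := halfz M (F d r).
have coverB (x : 'I_N) : exists p : 'I_k * 'I_n, absz (B p.1 p.2) == x.+1.
  have [xa|ax] := ltnP x a.
    have [||d [r [dk rn e]]] := cover (2 * x.+1); rewrite /in_range ?ifF; try lia.
    by exists (Ordinal dk, Ordinal rn); rewrite /B /= (abs_halfz_even M e).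
  have xN := ltn_ord x.
  have [||d [r [dk rn e]]] := cover (2 * (N.-1 - x)).+1; rewrite /in_range ?ifT; try lia.
  by exists (Ordinal dk, Ordinal rn); rewrite /B /= (abs_halfz_odd e); lia.
(* The entry in the chosen cell determines [x], so [g] is injective; equal cardinalities make it
   onto, hence no filled cell is zero and no absolute value repeats. *)
pose g x := xchoose (coverB x).
have gP x : absz (B (g x).1 (g x).2) = x.+1 by apply/eqP/(xchooseP (coverB x)).
have g_inj : injective g by move=> x y e; apply/val_inj; have := gP x; rewrite e gP => -[].
have g_bij : bijective g.
  by apply: inj_card_bij => //; rewrite card_prod !card_ord /N mulnC.
have onto (p : 'I_k * 'I_n) : exists x, p = g x.
  by case: g_bij => h _ hK; exists (h p); rewrite hK.
pose A (i j : 'I_n) := if subc n j i < k then B (subc n j i) i else 0%R.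
pose row_shift (i j : 'I_n) := Ordinal (ltn_addc (ltn_ord i) (ltn_ord j)).
pose col_shift (j i : 'I_n) := Ordinal (ltn_subc (ltn_ord j) (ltn_ord i)).
have row_shift_inj i : injective (row_shift i).
  by apply: (can_inj (g := fun j => col_shift j i)) => j; apply/val_inj; rewrite /= addcK.
have col_shift_inj j : injective (col_shift j).
  by apply: (can_inj (g := col_shift j)) => i; apply/val_inj; rewrite /= subcC.
have A_row i d : A i (row_shift i d) = if d < k then B d i else 0%R.
  by rewrite /A /= addcK.
have A_col j d : A (col_shift j d) j = if d < k then B d (col_shift j d) else 0%R.
  by rewrite /A /= subcC.
have AE (i j : 'I_n) : subc n j i < k -> exists x, A i j = B (g x).1 (g x).2 /\
   (val (g x).1 = subc n j i) /\ (g x).2 = i.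
  by move=> lt; have [x e] := onto (Ordinal lt, i); exists x; rewrite -e /A lt.
have A0 i j : (A i j != 0%R) = (subc n j i < k).
  apply/idP/idP; first by rewrite /A; case: ifP; rewrite ?eqxx.
  by move=> /AE[x [-> _]]; have := gP x; lia.
have card_prefix : #|[set d : 'I_n | d < k]| = k.
  by rewrite -sum1dep_card -(big_ord_widen n (fun=> 1) kn) sum1_card card_ord.
exists A; split; [|split; [|split; [|split; [|split]]]].
- move=> i; rewrite -[RHS]card_prefix -(card_imset _ (row_shift_inj i)); congr #|pred_of_set _|.
  apply/setP => j; rewrite !inE A0; apply/idP/imsetP => [lt|[d]].
    by exists (col_shift j i); rewrite ?inE //; apply/val_inj; rewrite /= subcK.
  by rewrite inE => lt ->; rewrite /= addcK.
- move=> j; rewrite -[RHS]card_prefix -(card_imset _ (col_shift_inj j)); congr #|pred_of_set _|.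
  apply/setP => i; rewrite !inE A0; apply/idP/imsetP => [lt|[d]].
    by exists (col_shift j i); rewrite ?inE //; apply/val_inj; rewrite /= subcC.
  by rewrite inE => lt ->; rewrite /= subcC.
- move=> i; rewrite (reindex_inj (row_shift_inj i)) /=.
  under eq_bigr do rewrite A_row.
  rewrite (sum_ord_prefix (fun d => B d i) kn) -mulnA; apply: dvdz_sum_halfz => //.
  exact: rows.
- move=> j; rewrite (reindex_inj (col_shift_inj j)) /=.
  under eq_bigr do rewrite A_col.
  rewrite (sum_ord_prefix (fun d => B d (subc n j d)) kn) -mulnA.
  by apply: dvdz_sum_halfz => //; apply: cols.
- by move=> i j; rewrite A0 => /AE[x [-> _]]; rewrite gP; apply: ltn_ord.
move=> x /andP[x0 xN].
have xN' : x.-1 < N by rewrite prednK.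
pose p := g (Ordinal xN').
apply/eqP/cards1P; exists (p.2, row_shift p.2 (widen_ord kn p.1)).
apply/setP => -[i j]; rewrite !inE /=; apply/eqP/eqP => [Ax|[-> ->]].
  have /AE[y [Ay [gy1 gy2]]] : subc n j i < k by rewrite -A0; lia.
  have yE : y = Ordinal xN' by apply/val_inj; have := gP y; rewrite -Ay Ax /=; lia.
  rewrite /p -yE gy2; congr (_, _); apply/val_inj => /=.
  by rewrite gy1 subcK.
by rewrite A_row /= ltn_ord gP /=; lia.
Qed.

(** * Adding four diagonals, and the even base cases *)

Lemma subc_addc n c d : c < n -> d < n -> addc n (subc n c d) d = c.
Proof. by rewrite /addc /subc => cn dn; case: (leqP d c) => ?; case: ifP; lia. Qed.

Lemma subcS_addc n c d : c < n -> d.+1 < n -> addc n (subc n c d.+1) d = subc n c 1.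
Proof.
by rewrite /addc /subc => cn dn; case: (leqP d.+1 c) => ?; do 2 (case: ifP; try lia).
Qed.

(* Along the diagonals [k], [k+1] consecutive even numbers alternate in sign, which
   makes every row sum [-2] and every column sum [2], except in column [0]; the
   diagonals [k+2], [k+3], indexed by their column too, cancel all of these sums. *)
Definition quad n a k d r : int :=
  match d with
  | 0 => (2 * a + 4 * addc n r k + 2)%:Z
  | 1 => - (2 * a + 4 * addc n r k + 4)%:Z
  | 2 => - (2 * a + 4 * n + 4 * addc n r (k + 2) + 2)%:Z
  | _ => (2 * a + 4 * n + 4 * addc n r (k + 2) + 4)%:Z
  end.

Lemma cyclic_array_add4 n k F a b : k + 4 <= n ->
  cyclic_array n k F a b -> exists F', cyclic_array n (k + 4) F' (a + 4 * n) b.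
Proof.
move=> k4n [[rows cols] abnk cover].
pose F' d r := if d < k then F d r else quad n a k (d - k) r.
have sumF' (s : nat -> nat) : (\sum_(d < k + 4) F' d (s d) = \sum_(d < k) F d (s d) +
    \sum_(e < 4) quad n a k e (s (k + e)%N))%R.
  rewrite big_split_ord /=; congr (_ + _)%R; apply: eq_bigr => i _; rewrite /F'.
    by rewrite ltn_ord.
  by rewrite ltnNge leq_addr addKn.
exists F'; split; [split=> [r rn|c cn]| |].
- by rewrite (sumF' (fun=> r)) rows // !big_ord_recl big_ord0 /=; lia.
- rewrite (sumF' (subc n c)) cols // !big_ord_recl big_ord0 /= /bump /=.
  rewrite addn0 !addn1 (addnS k 2) subc_addc ?subcS_addc ?subc_addc; lia.
- by rewrite mulnDr -abnk; lia.
move=> x x0 xab; have [x_old|x_new] := boolP (in_range a b x).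
  have [d [r [dk rn e]]] := cover x x0 x_old.
  by exists d, r; rewrite /F' dk; split=> //; lia.
(* The new values are the [4 * n] even numbers after [2 * a]. Halving the offset gives the row, its
   parity the diagonal within a pair. *)
have {x_new xab} : exists y, x = 2 * a + 2 * y.+1 /\ y < 4 * n.
  by exists (x./2 - a.+1); move: x_new xab; rewrite /in_range; case: ifP; lia.
move=> [y [-> yn]].
have F'k e r : F' (k + e) r = quad n a k e r by rewrite /F' ltnNge leq_addr addKn.
have kn : k < n by lia.
have k2n : k + 2 < n by lia.
have [y_lo|y_hi] := ltnP y (2 * n).
  have tn : y./2 < n by lia.
  exists (k + odd y), (subc n y./2 k).
  by rewrite F'k ltn_subc //; split => //; case: (boolP (odd y)) => oy /=; rewrite ?subc_addc //; lia.
have tn : (y - 2 * n)./2 < n by lia.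
exists (k + (2 + odd y)), (subc n (y - 2 * n)./2 (k + 2)).
by rewrite F'k ltn_subc //; split => //; case: (boolP (odd y)) => oy /=; rewrite ?subc_addc //; lia.
Qed.

Lemma cyclic_array_addn4 n k j F a b : k + 4 * j <= n ->
  cyclic_array n k F a b -> exists F' a', cyclic_array n (k + 4 * j) F' a' b.
Proof.
elim: j => [|j IH] kn C; first by exists F, a; rewrite addn0.
have [|F' [a' C']] := IH _ C; first by lia.
have [|F'' C''] := cyclic_array_add4 _ C'; first by lia.
by exists F'', (a' + 4 * n); rewrite mulnS addnCA addnC.
Qed.

(** Starting point for [k] divisible by 4. *)
Lemma cyclic_array0 n : cyclic_array n 0 (fun _ _ => 0%R) 0 0.
Proof.
split=> [||x x0]; [by split=> *; rewrite big_ord0 | by rewrite muln0 |].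
by rewrite /in_range; case: ifP; lia.
Qed.

(* Two pairs of diagonals with step [1] against one pair with step [2]: the
   exceptional sums in column [0] cancel as well. *)
Definition hexad n d r : int :=
  match d with
  | 0 => (2 * r + 1)%:Z
  | 1 => - (2 * r + 2)%:Z
  | 2 => (2 * n + 2 * addc n r 2 + 1)%:Z
  | 3 => - (2 * n + 2 * addc n r 2 + 2)%:Z
  | 4 => - (4 * n + 4 * addc n r 4 + 1)%:Z
  | _ => (4 * n + 4 * addc n r 4 + 3)%:Z
  end.

(** The pairs carry [{1,..,2n}], [{2n+1,..,4n}] and the odd numbers between [4n] and [8n]. *)
Lemma cyclic_array6 n : 6 <= n -> cyclic_array n 6 (hexad n) (2 * n) (4 * n).
Proof.
move=> n6; split; [split=> [r rn|c cn]| lia |].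
- by rewrite !big_ord_recl big_ord0 /= /bump /=; lia.
- rewrite !big_ord_recl big_ord0 /= /bump /= !subc_addc ?subcS_addc; try lia.
  by have -> : subc n c 0 = c; rewrite ?addn0 /subc /=; lia.
move=> x x0 xr.
have [x2|x2] := leqP x (2 * n).
  exists (~~ odd x : nat), x.-1./2; split; try lia.
  by case: (boolP (odd x)) => ox /=; lia.
have [x4|x4] := leqP x (4 * n).
  have tn : (x - 2 * n).-1./2 < n by lia.
  exists (2 + ~~ odd x), (subc n (x - 2 * n).-1./2 2); rewrite ltn_subc //; last by lia.
  by split=> //; case: (boolP (odd x)) => ox /=; rewrite ?subc_addc //; lia.
have ox : odd x by move: xr; rewrite /in_range; case: ifP; lia.
have x8 : x < 8 * n by move: xr; rewrite /in_range ox; lia.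
have tn : (x - 4 * n).-1./2./2 < n by lia.
exists (4 + odd (x - 4 * n).-1./2), (subc n (x - 4 * n).-1./2./2 4); rewrite ltn_subc //; last by lia.
split=> //; case: (boolP (odd _./2)) => oy /=; rewrite ?subc_addc //; lia.
Qed.

(** * Three and five diagonals from a cyclic sequence *)

(* The range [{1,..,N}], or [{1,..,N-1,N+1}] if [h], as for hooked Skolem sequences;
   the latter has an even number of odd elements when the former does not. *)
Definition hooked (h : bool) N x := (x < N) || (x == N + h).

(** Replacing [N] by [N + 1] changes the parity of the largest element, which moves one unit between
    [a] and [b]. *)
Lemma in_range_hooked (h : bool) N : 1 < N ->
  exists a b, a + b = N /\ forall x, in_range a b x -> hooked h N x.
Proof.
move=> N1; case: h.
  exists (if odd N then N.+1./2 else N./2.-1), (if odd N then N./2 else N./2.+1).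
  split=> [|x]; first by case: ifP; lia.
  by rewrite /in_range /hooked; case: (boolP (odd N)) => ?; case: ifP; lia.
exists N./2, (uphalf N); split=> [|x]; first lia.
by rewrite /in_range /hooked; case: ifP; lia.
Qed.

Lemma subc_subc1 n c d : c < n -> d.+1 < n -> subc n (subc n c d) 1 = subc n c d.+1.
Proof.
by rewrite /subc => cn dn; case: (leqP d c) => ?; do 2 (case: ifP; try lia).
Qed.

(* Row [r] has [- (b r + b (r-1) + K)] in the middle, [b r] to its right and
   [b (r-1) + K] to its left, so that the cells mirrored at the middle diagonal
   differ by [K]. *)
Definition triad n (b : nat -> int) (K : int) d r : int :=
  match d with
  | 0 => b (subc n r 1) + K
  | 1 => - (b r + b (subc n r 1) + K)
  | _ => b r
  end.

(** Column [c] shares its middle cell with row [c - 1]; mirroring only moves [K] from one outer cell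
    to the other. *)
Lemma triad_balanced n b K : 3 <= n -> balanced n 3 (triad n b K).
Proof.
move=> n3; split=> [r rn|c cn]; rewrite !big_ord_recl big_ord0 /= /bump /=; first lia.
have -> : subc n c 0 = c by rewrite /subc subn0.
by rewrite !(addn0, add1n) subc_subc1 //; lia.
Qed.

(* The outermost mirrored cells hold [1 - w r - g'] and [g' - w r]; their negative
   dependence on [w] makes the middle entry a difference of neighbours. *)
Definition pentad n (w : nat -> int) (g g' : int) d r : int :=
  match d with
  | 0 => g' - w (subc n r 2)
  | 1 => w (subc n r 1) + g - 1
  | 2 => w (subc n r 2) - w (subc n r 1)
  | 3 => w r - g
  | _ => 1 - w r - g'
  end.

Lemma subc_subc2 n c d : c < n -> d.+2 < n -> subc n (subc n c d) 2 = subc n c d.+2.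
Proof.
by rewrite /subc => cn dn; case: (leqP d c) => ?; do 2 (case: ifP; try lia).
Qed.

Lemma pentad_balanced n w g g' : 5 <= n -> balanced n 5 (pentad n w g g').
Proof.
move=> n5; split=> [r rn|c cn]; rewrite !big_ord_recl big_ord0 /= /bump /=; first lia.
have -> : subc n c 0 = c by rewrite /subc subn0.
by rewrite !(addn0, add1n) !subc_subc2 ?subc_subc1; lia.
Qed.

Definition edge_sum (u v : int) := absz (u + v - 1)%R.
Definition edge_diff (u v : int) := absz (u - v)%R.

(* [w] stands for the half-integer [w - 1/2], so that [x] and [1 - x] have the same
   absolute value and [edge_sum] is the absolute value of a sum. *)
Definition vertex_cover n h (w : nat -> int) := forall x, 0 < x -> hooked h n x ->
  exists r, r < n /\ (w r = x%:Z \/ w r = 1 - x%:Z)%R.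

(** Signed differences around the cycle add up to 0, and signed sums to [n] modulo 2, so a given
    [n > 0] admits at most one [h]. *)
Definition edge_cover n h e (w : nat -> int) := forall x, 0 < x -> hooked h n x ->
  (exists r, r.+1 < n /\ e (w r.+1) (w r) = x) \/ e (w 0) (w n.-1) = x.

Lemma edge_coverE n h e w : 0 < n -> edge_cover n h e w ->
  forall x, 0 < x -> hooked h n x -> exists r, r < n /\ e (w r) (w (subc n r 1)) = x.
Proof.
move=> n0 cov x x0 /cov -/(_ x0) [[r [rn <-]]|<-].
  by exists r.+1; rewrite /subc subn1.
by exists 0; rewrite /subc /= subn1.
Qed.

Lemma shift_edge n r : r < n -> subc n (addc n r 1) 1 = r.
Proof. by rewrite /subc /addc => rn; case: (ltnP (r + 1) n) => ?; case: ifP; lia. Qed.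

Lemma cyclic_array_triad n h (b : nat -> int) (K : int) : 3 <= n ->
  (forall x, 0 < x -> hooked h (n * 3) x ->
    (exists r, r < n /\ (absz (b r) = x \/ absz (b r + K)%R = x)) \/
    (exists r, r < n /\ absz (b r + b (subc n r 1) + K)%R = x)) ->
  exists F a a', cyclic_array n 3 F a a'.
Proof.
move=> n3 cover; have [|a [a' [aa' rangeP]]] := @in_range_hooked h (n * 3); first lia.
exists (triad n b K), a, a'; split=> [|//|x x0 /rangeP hx]; first exact: triad_balanced.
have [[r [rn [e|e]]]|[r [rn e]]] := cover x x0 hx.
- by exists 2, r.
- by exists 0, (addc n r 1); rewrite /= shift_edge // ltn_addc //; lia.
by exists 1, r; rewrite /= abszN.
Qed.

(** With [K = 4n + 1] the middle entries are edge sums and the outer ones have absolute values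
    [2n + y] and [2n + 1 - y]. In the hooked case the latter skip [n + 1] and reach [n], just where
    the edges do the opposite. *)
Lemma cyclic_array3 n h w : 3 <= n -> vertex_cover n h w -> edge_cover n h edge_sum w ->
  exists F a b, cyclic_array n 3 F a b.
Proof.
move=> n3 vcov /edge_coverE ecov.
apply: (@cyclic_array_triad n h (fun r => w r - (2 * n).+1%:Z)%R (4 * n + 1)%:Z) => // x x0 hx.
have [small|big] := boolP (hooked h n x); [right|left].
  have [|r [rn <-]] := ecov _ x x0 small; first lia.
  by exists r; split=> //; rewrite /edge_sum; lia.
have [y [y0 hy xy]] : exists y, [/\ 0 < y, hooked h n y & x = 2 * n + y \/ x + y = 2 * n + 1].
  exists (if x <= 2 * n then 2 * n + 1 - x else x - 2 * n).
  by move: hx big; rewrite /hooked; case: ifP; split; lia.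
by have [r [rn wr]] := vcov y y0 hy; exists r; split=> //; lia.
Qed.

(** The outer values are [2n + y], [2n + 1 - y], [4n + y] and [4n + 1 - y], whose hooks interlock as
    for three diagonals. *)
Lemma cyclic_array5 n h w : 5 <= n -> vertex_cover n h w -> edge_cover n h edge_diff w ->
  exists F a b, cyclic_array n 5 F a b.
Proof.
move=> n5 vcov /edge_coverE ecov; have [|a [b [ab rangeP]]] := @in_range_hooked h (n * 5); first lia.
exists (pentad n w (2 * n).+1%:Z (4 * n).+1%:Z), a, b.
split=> [|//|x x0 /rangeP hx]; first exact: pentad_balanced.
have shiftK r d : r < n -> d < n -> subc n (addc n r d) d = r.
  by move=> rn dn; rewrite /subc /addc; case: (ltnP (r + d) n) => ?; case: ifP; lia.
have n1 : 1 < n by lia.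
have [small|big] := boolP (hooked h n x).
  have [|r [rn <-]] := ecov _ x x0 small; first lia.
  exists 2, (addc n r 1); rewrite ltn_addc //=.
  have -> : subc n (addc n r 1) 2 = subc n r 1.
    have rn1 := ltn_addc rn n1.
    by rewrite -subc_subc1 ?shiftK //; lia.
  by rewrite shiftK // /edge_diff; split=> //; lia.
have [y [y0 hy]] : exists y, [/\ 0 < y, hooked h n y &
    x = 2 * n + y \/ x + y = 2 * n + 1 \/ x = 4 * n + y \/ x + y = 4 * n + 1].
  exists (if x <= 2 * n then 2 * n + 1 - x else if hooked h (3 * n) x then x - 2 * n
          else if x <= 4 * n then 4 * n + 1 - x else x - 4 * n).
  by move: hx big; rewrite /hooked; case: h {vcov ecov rangeP}; repeat case: ifP; split; lia.
have [r [rn wr]] := vcov y y0 hy => xy.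
have [e|[e|[e|e]]] : absz (w r - (2 * n).+1%:Z)%R = x \/ absz (w r + (2 * n)%:Z)%R = x \/
    absz ((4 * n).+1%:Z - w r)%R = x \/ absz (w r + (4 * n)%:Z)%R = x.
  by case: xy => [?|[?|[?|?]]]; case: wr => ?; lia.
- by exists 3, r.
- by exists 1, (addc n r 1); rewrite ltn_addc //= ?shiftK; try split; lia.
- by exists 0, (addc n r 2); rewrite ltn_addc //= ?shiftK; try split; lia.
by exists 4, r; split=> //=; lia.
Qed.

(** * Zigzag sequences *)

(** Sums of neighbours form an arithmetic progression if [da = db]; differences do so, up to sign,
    if [da = - db]. *)
Definition zigzag (a da b db : int) i : int :=
  (if odd i then b + db * (i./2)%:Z else a + da * (i./2)%:Z)%R.

(** Edge values: [2m] down to 1 in the first zigzag, [2m + 1] on reaching 0, then [4m - 1] down to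
    [2m + 2], and [4m] on closing. *)
Definition sum_seq0 (m r : nat) : int :=
  if r < 2 * m + 1 then zigzag (- (3 * m)%:Z) 1 (m + 1)%:Z 1 r
  else if r == 2 * m + 1 then 0%R
  else zigzag (4 * m)%:Z (- 1) (- 1) (- 1) (r - (2 * m + 2)).

Ltac zigzag_lia :=
  rewrite /edge_sum /edge_diff /zigzag ?eqxx; do ?[case: ifP => ?]; lia.

Lemma sum_seq0_vertex m : 0 < m -> vertex_cover (4 * m) false (sum_seq0 m).
Proof.
move=> m0 x x0; rewrite /hooked /sum_seq0 => hx.
have [x1|x1] := leqP x 1; first by exists (2 * m + 1); zigzag_lia.
have [x2|x2] := leqP x m; first by exists (2 * m + 2 * x - 1); zigzag_lia.
have [x3|x3] := leqP x (2 * m); first by exists (2 * (x - m) - 1); zigzag_lia.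
have [x4|x4] := leqP x (3 * m + 1); first by exists (2 * (3 * m + 1 - x)); zigzag_lia.
by exists (2 * m + 2 + 2 * (4 * m - x)); zigzag_lia.
Qed.

Lemma sum_seq0_edge m : 0 < m -> edge_cover (4 * m) false edge_sum (sum_seq0 m).
Proof.
move=> m0 x x0; rewrite /hooked /sum_seq0 => hx.
have [x1|x1] := leqP x (2 * m); first by left; exists (2 * m - x); zigzag_lia.
have [x2|x2] := leqP x (2 * m + 1); first by left; exists (2 * m); zigzag_lia.
have [x3|x3] := leqP x (4 * m - 1); first by left; exists (6 * m - x); zigzag_lia.
by right; zigzag_lia.
Qed.

Definition sum_seq1 (m r : nat) : int :=
  if r < 2 * m then zigzag (- (3 * m)%:Z) 1 (m + 2)%:Z 1 r
  else if r == 2 * m then 0%R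
  else zigzag (4 * m + 1)%:Z (- 1) (- 1) (- 1) (r - (2 * m + 1)).

Lemma sum_seq1_vertex m : 0 < m -> vertex_cover (4 * m + 1) false (sum_seq1 m).
Proof.
move=> m0 x x0; rewrite /hooked /sum_seq1 => hx.
have [x1|x1] := leqP x 1; first by exists (2 * m); zigzag_lia.
have [x2|x2] := leqP x (m + 1); first by exists (2 * m + 2 * x - 2); zigzag_lia.
have [x3|x3] := leqP x (2 * m + 1); first by exists (2 * (x - m) - 3); zigzag_lia.
have [x4|x4] := leqP x (3 * m + 1); first by exists (2 * (3 * m + 1 - x)); zigzag_lia.
by exists (2 * m + 1 + 2 * (4 * m + 1 - x)); zigzag_lia.
Qed.

Lemma sum_seq1_edge m : 0 < m -> edge_cover (4 * m + 1) false edge_sum (sum_seq1 m).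
Proof.
move=> m0 x x0; rewrite /hooked /sum_seq1 => hx.
have [x1|x1] := leqP x (2 * m - 1); first by left; exists (2 * m - 1 - x); zigzag_lia.
have [x2|x2] := leqP x (2 * m); first by left; exists (2 * m - 1); zigzag_lia.
have [x3|x3] := leqP x (4 * m); first by left; exists (6 * m - x); zigzag_lia.
by right; zigzag_lia.
Qed.

(** The hooked vertex [4m + 3] stands next to 1, so the first edge takes the hooked value as
    well. *)
Definition sum_seq2 (m r : nat) : int :=
  if r == 0 then Posz (4 * m + 3)
  else if r < 2 * m then zigzag 1 1 (- (4 * m)%:Z) 1 (r - 1)
  else zigzag (3 * m + 2)%:Z (- 1) (- m%:Z) (- 1) (r - 2 * m).

Lemma sum_seq2_vertex m : 0 < m -> vertex_cover (4 * m + 2) true (sum_seq2 m).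
Proof.
move=> m0 x x0; rewrite /hooked /sum_seq2 => hx.
have [x1|x1] := leqP x m; first by exists (2 * x - 1); zigzag_lia.
have [x2|x2] := leqP x (2 * m + 1); first by exists (2 * x - 1); zigzag_lia.
have [x3|x3] := leqP x (3 * m + 2); first by exists (2 * m + 2 * (3 * m + 2 - x)); zigzag_lia.
have [x4|x4] := leqP x (4 * m + 1); first by exists (2 + 2 * (4 * m + 1 - x)); zigzag_lia.
by exists 0; zigzag_lia.
Qed.

Lemma sum_seq2_edge m : 0 < m -> edge_cover (4 * m + 2) true edge_sum (sum_seq2 m).
Proof.
move=> m0 x x0; rewrite /hooked /sum_seq2 => hx.
have [x1|x1] := eqVneq x (2 * m + 2); first by right; zigzag_lia.
have [x2|x2] := eqVneq x (4 * m + 1); first by left; exists (2 * m - 1); zigzag_lia.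
have [x3|x3] := leqP x (4 * m); first by left; exists (4 * m + 1 - x); zigzag_lia.
by left; exists 0; zigzag_lia.
Qed.

Definition diff_seq1 (m r : nat) : int :=
  if r == 0 then Posz (4 * m + 2)
  else if r < 2 * m then zigzag 0 (- 1) (1 - (4 * m)%:Z) 1 (r - 1)
  else zigzag (3 * m + 1)%:Z (- 1) (m + 1)%:Z 1 (r - 2 * m).

Lemma diff_seq1_vertex m : 0 < m -> vertex_cover (4 * m + 1) true (diff_seq1 m).
Proof.
move=> m0 x x0; rewrite /hooked /diff_seq1 => hx.
have [x1|x1] := leqP x m; first by exists (2 * x - 1); zigzag_lia.
have [x2|x2] := leqP x (2 * m); first by exists (2 * x - 1); zigzag_lia.
have [x3|x3] := leqP x (3 * m + 1); first by exists (2 * m + 2 * (3 * m + 1 - x)); zigzag_lia.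
have [x4|x4] := leqP x (4 * m); first by exists (2 + 2 * (4 * m - x)); zigzag_lia.
by exists 0; zigzag_lia.
Qed.

Lemma diff_seq1_edge m : 0 < m -> edge_cover (4 * m + 1) true edge_diff (diff_seq1 m).
Proof.
move=> m0 x x0; rewrite /hooked /diff_seq1 => hx.
have [x1|x1] := eqVneq x (2 * m + 1); first by right; zigzag_lia.
have [x2|x2] := eqVneq x (4 * m); first by left; exists (2 * m - 1); zigzag_lia.
have [x3|x3] := leqP x (4 * m); first by left; exists (4 * m - x); zigzag_lia.
by left; exists 0; zigzag_lia.
Qed.

Definition diff_seq3 (m r : nat) : int :=
  if r < 2 * m + 2 then zigzag (- (3 * m + 2)%:Z) 1 (- (m + 1)%:Z) (- 1) r
  else zigzag 1 1 (4 * m + 3)%:Z (- 1) (r - (2 * m + 2)).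

Lemma diff_seq3_vertex m : vertex_cover (4 * m + 3) false (diff_seq3 m).
Proof.
move=> x x0; rewrite /hooked /diff_seq3 => hx.
have [x1|x1] := leqP x (m + 1); first by exists (2 * m + 2 * x); zigzag_lia.
have [x2|x2] := leqP x (2 * m + 2); first by exists (2 * (x - m) - 3); zigzag_lia.
have [x3|x3] := leqP x (3 * m + 3); first by exists (2 * (3 * m + 3 - x)); zigzag_lia.
by exists (2 * m + 3 + 2 * (4 * m + 3 - x)); zigzag_lia.
Qed.

Lemma diff_seq3_edge m : edge_cover (4 * m + 3) false edge_diff (diff_seq3 m).
Proof.
move=> x x0; rewrite /hooked /diff_seq3 => hx.
have [x1|x1] := leqP x (2 * m + 1); first by left; exists (2 * m + 1 - x); zigzag_lia.
have [x2|x2] := leqP x (2 * m + 2); first by left; exists (2 * m + 1); zigzag_lia.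
have [x3|x3] := leqP x (4 * m + 2); first by left; exists (6 * m + 4 - x); zigzag_lia.
by right; zigzag_lia.
Qed.

(* For [n = 4m+3] the sequence is used as [b] in [triad] with [K = 3m+2]; the junction
   of its two parts yields the hooked value [12m+10]. *)
Definition triad_seq3 (m r : nat) : int :=
  if r < 2 * m + 1 then zigzag (- (11 * m + 8)%:Z) 1 (8 * m + 7)%:Z 1 r
  else zigzag (- (5 * m + 4)%:Z) (- 1) (7 * m + 5)%:Z (- 1) (r - (2 * m + 1)).

Lemma triad_seq3_edge m x : 0 < x <= 2 * m + 1 \/ 3 * m + 3 <= x <= 5 * m + 3 \/ x = 12 * m + 10 ->
  exists r, r < 4 * m + 3 /\
    absz (triad_seq3 m r + triad_seq3 m (subc (4 * m + 3) r 1) + (3 * m + 2)%:Z)%R = x.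
Proof.
have step r y : r.+1 < 4 * m + 3 ->
    absz (triad_seq3 m r.+1 + triad_seq3 m r + (3 * m + 2)%:Z)%R = y ->
    exists r, r < 4 * m + 3 /\
      absz (triad_seq3 m r + triad_seq3 m (subc (4 * m + 3) r 1) + (3 * m + 2)%:Z)%R = y.
  by exists r.+1; rewrite /subc subn1.
have [->|x1] := eqVneq x (2 * m + 1) => hx.
  by exists 0; rewrite /subc /triad_seq3 /=; split; zigzag_lia.
have [x2|x2] := leqP x (2 * m); first by apply: (step (x - 1)); rewrite /triad_seq3; zigzag_lia.
have [x3|x3] := leqP x (5 * m + 3); first by apply: (step (7 * m + 4 - x)); rewrite /triad_seq3; zigzag_lia.
by apply: (step (2 * m)); rewrite /triad_seq3; zigzag_lia.
Qed.

(** The four progressions and their translates by [3m + 2] are eight intervals, filling what the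
    sums leave open. *)
Lemma triad_seq3_cover m x : 0 < x -> hooked true ((4 * m + 3) * 3) x ->
  (exists r, r < 4 * m + 3 /\
    (absz (triad_seq3 m r) = x \/ absz (triad_seq3 m r + (3 * m + 2)%:Z)%R = x)) \/
  (exists r, r < 4 * m + 3 /\
    absz (triad_seq3 m r + triad_seq3 m (subc (4 * m + 3) r 1) + (3 * m + 2)%:Z)%R = x).
Proof.
rewrite /hooked => x0 hx.
have [edge|vertex] :=
  boolP [|| x <= 2 * m + 1, 3 * m + 3 <= x <= 5 * m + 3 | x == 12 * m + 10].
  by right; apply: triad_seq3_edge; lia.
left; rewrite /triad_seq3.
have [x1|x1] := leqP x (3 * m + 2); first by exists (2 * (x - m) - 3); zigzag_lia.
have [x2|x2] := leqP x (6 * m + 4); first by exists (2 * (x - 4 * m) - 7); zigzag_lia.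
have [x3|x3] := leqP x (7 * m + 5); first by exists (2 * m + 2 + 2 * (7 * m + 5 - x)); zigzag_lia.
have [x4|x4] := leqP x (8 * m + 6); first by exists (2 * (8 * m + 6 - x)); zigzag_lia.
have [x5|x5] := leqP x (9 * m + 6); first by exists (2 * (x - (8 * m + 7)) + 1); zigzag_lia.
have [x6|x6] := leqP x (10 * m + 7); first by exists (2 * m + 2 + 2 * (10 * m + 7 - x)); zigzag_lia.
have [x7|x7] := leqP x (11 * m + 8); first by exists (2 * (11 * m + 8 - x)); zigzag_lia.
by exists (2 * (x - (11 * m + 9)) + 1); zigzag_lia.
Qed.

(** * From sums to differences, and assembly *)

Definition flip_odd (w : nat -> int) r : int := (if odd r then 1 - w r else w r)%R.

Lemma vertex_cover_flip_odd n h w : vertex_cover n h w -> vertex_cover n h (flip_odd w).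
Proof.
move=> cov x x0 /(cov x x0)[r [rn wr]]; exists r; split=> //.
by rewrite /flip_odd; case: ifP; lia.
Qed.

(** Reflecting one end of an edge turns its sum into a difference up to sign; for even [n] the
    closing edge also joins an even and an odd position. *)
Lemma edge_cover_flip_odd n h w : 0 < n -> ~~ odd n ->
  edge_cover n h edge_sum w -> edge_cover n h edge_diff (flip_odd w).
Proof.
move=> n0 n_even cov x x0 /(cov x x0)[[r [rn e]]|e]; [left; exists r; split=> // | right].
  by move: e; rewrite /edge_sum /edge_diff /flip_odd /=; case: (odd r) => /=; lia.
have -> : flip_odd w n.-1 = (1 - w n.-1)%R by rewrite /flip_odd ifT //; lia.
by move: e; rewrite /edge_sum /edge_diff /flip_odd /=; lia.
Qed.

Lemma mod4P n : exists m, [\/ n = 4 * m, n = 4 * m + 1, n = 4 * m + 2 | n = 4 * m + 3].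
Proof.
exists (n %/ 4).
have [e|[e|[e|e]]] : n %% 4 = 0 \/ n %% 4 = 1 \/ n %% 4 = 2 \/ n %% 4 = 3 by lia.
- by constructor 1; lia.
- by constructor 2; lia.
- by constructor 3; lia.
by constructor 4; lia.
Qed.

Lemma exists_cyclic_array3 n : 3 <= n -> exists F a b, cyclic_array n 3 F a b.
Proof.
have [m [] -> n3] := mod4P n.
- by apply: cyclic_array3 (sum_seq0_vertex _) (sum_seq0_edge _); lia.
- by apply: cyclic_array3 (sum_seq1_vertex _) (sum_seq1_edge _); lia.
- by apply: cyclic_array3 (sum_seq2_vertex _) (sum_seq2_edge _); lia.
- exact: cyclic_array_triad (triad_seq3_cover (m := m)).
Qed.

Lemma exists_cyclic_array5 n : 5 <= n -> exists F a b, cyclic_array n 5 F a b.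
Proof.
have [m [] -> n5] := mod4P n.
- apply: cyclic_array5 (vertex_cover_flip_odd (sum_seq0_vertex _))
    (edge_cover_flip_odd _ _ (sum_seq0_edge _)); lia.
- by apply: cyclic_array5 (diff_seq1_vertex _) (diff_seq1_edge _); lia.
- apply: cyclic_array5 (vertex_cover_flip_odd (sum_seq2_vertex _))
    (edge_cover_flip_odd _ _ (sum_seq2_edge _)); lia.
- by apply: cyclic_array5 (@diff_seq3_vertex m) (@diff_seq3_edge m).
Qed.

Lemma exists_cyclic_array n k : 3 <= k <= n -> exists F a b, cyclic_array n k F a b.
Proof.
move=> /andP[k3 kn].
have extend k0 j F a b : k = k0 + 4 * j -> cyclic_array n k0 F a b ->
    exists F' a' b', cyclic_array n k F' a' b'.
  move=> kE C; have [|F' [a' C']] := @cyclic_array_addn4 n k0 j F a b _ C; first by rewrite -kE.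
  by exists F', a', b; rewrite kE.
(* The residues 0, 1, 2, 3 of [k] start from 0, 5, 6, 3 diagonals, since [k] is at least 3. *)
have [j [] kE] := mod4P k.
- by apply: (extend 0 j _ _ _ _ (cyclic_array0 n)); lia.
- have [|F [a [b C]]] := @exists_cyclic_array5 n; first by lia.
  by apply: (extend 5 j.-1 _ _ _ _ C); lia.
- have n6 : 6 <= n by lia.
  by apply: (extend 6 j.-1 _ _ _ _ (cyclic_array6 n6)); lia.
have [|F [a [b C]]] := @exists_cyclic_array3 n; first by lia.
by apply: (extend 3 j _ _ _ _ C); lia.
Qed.

Theorem theorem1p4 (n k : nat) (hn : (0 < n)%N) (hk : (0 < k)%N) :
  (exists A : 'I_n -> 'I_n -> int, is_heffter k A) <-> (3 <= k <= n)%N.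
Proof.
split=> [[A]|kn]; first exact: heffter_order_ge3.
have [F [a [b C]]] := exists_cyclic_array kn.
by apply: heffter_of_cyclic_array C => //; case/andP: kn.
Qed.
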